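(* Let $d\ge1$, let $\phi\in\mathbb{R}^{d+1}\setminus S^d$, and suppose $Y\sim C_d^*(\phi)$. Let $R$ be any (fixed) $(d+1)\times(d+1)$ real matrix. Then $\mathcal{M}_{R,-\phi}(Y)$ is a pivotal statistic for $\phi$, i.e. the distribution of $\mathcal{M}_{R,-\phi}(Y)$ does not depend on $\phi$.
   Context: $S^d=\{x\in\mathbb{R}^{d+1}:\|x\|=1\}$. For $\phi\in\mathbb{R}^{d+1}\setminus S^d$, $Y\sim C_d^*(\phi)$ means that the $S^d$-valued random vector $Y$ has density, with respect to surface area on $S^d$, $$f(y;\phi)=\frac{\Gamma\{(d+1)/2\}}{2\pi^{(d+1)/2}}\left(\frac{|1-\|\phi\|^2|}{\|y-\phi\|^2}\right)^d,\quad y\in S^d.$$ For $\psi\in\mathbb{R}^{d+1}\setminus S^d$ and a $(d+1)\times(d+1)$ matrix $R$, $$\mathcal{M}_{R,\psi}(y)=R\left\{\frac{1-\|\psi\|^2}{\|y+\psi\|^2}(y+\psi)+\psi\right\},\quad y\in S^d.$$ *)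

(* Defs.v *)
From HB Require Import structures.
From mathcomp Require Import all_boot all_order all_algebra.
From mathcomp Require Import all_classical all_reals all_analysis.
Set Implicit Arguments.
Unset Strict Implicit.
Unset Printing Implicit Defensive.
Import Order.TTheory GRing.Theory Num.Theory.
Import numFieldNormedType.Exports.
Local Open Scope classical_set_scope.
Local Open Scope ring_scope.

Section euclidean_space.
Variable R : realType.

(* The norm `|x| provided by the library on matrices is the max norm. *)
Definition enorm (n : nat) (x : 'cV[R]_n) : R :=
  Num.sqrt (\sum_(i < n) x i 0 ^+ 2).

Definition borel_cV (n : nat) := g_sigma_algebraType (@open 'cV[R]_n).

HB.instance Definition _ (n : nat) := Measurable.on (borel_cV n).

Definition sphere (d : nat) : set 'cV[R]_d.+1 := [set x | enorm x = 1].

Definition Gamma (a : R) : R :=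
  (\int[lebesgue_measure]_(t in `]0%R, +oo[) (t `^ (a - 1) * expR (- t)))%R.

Local Open Scope ereal_scope.

Definition diam (n : nat) (U : set 'cV[R]_n) : \bar R :=
  ereal_sup [set (enorm (p.1 - p.2))%:E | p in U `*` U].

(* Volume of the unit ball of R^d, divided by 2^d: with this factor,
   d-dimensional Hausdorff measure agrees with Lebesgue measure on R^d and
   with surface area on d-dimensional submanifolds of R^n. *)
Definition hausdorff_const (d : nat) : R :=
  (pi `^ (d%:R / 2) / Gamma (d%:R / 2 + 1) / 2 ^+ d)%R.

(* The empty set is separated because diam set0 = -oo. *)
Definition hausdorff_gauge (d n : nat) (U : set 'cV[R]_n) : \bar R :=
  if U == set0 then 0 else (hausdorff_const d)%:E * diam U ^+ d.

Definition hausdorff_delta (d n : nat) (delta : R) (A : set 'cV[R]_n) : \bar R :=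
  ereal_inf [set \sum_(k <oo) hausdorff_gauge d (F k) |
    F in [set F : (set 'cV[R]_n)^nat |
      A `<=` \bigcup_k F k /\ forall k, diam (F k) <= delta%:E]].

Definition hausdorff_measure (d n : nat) (A : set (borel_cV n)) : \bar R :=
  ereal_sup [set hausdorff_delta d delta A | delta in [set x : R | (0 < x)%R]].

End euclidean_space.

Arguments sphere {R} d _.
Arguments hausdorff_measure {R} d {n} A.

Section hausdorff_measure_is_measure.
Variable R : realType.
Local Open Scope ereal_scope.

Lemma Gamma_ge0 (a : R) : (0 <= Gamma a)%R.
Proof.
by apply: Rintegral_ge0 => t _; rewrite mulr_ge0 ?powR_ge0 ?expR_ge0.
Qed.

Variables d n : nat.
Implicit Types (U A B C : set 'cV[R]_n) (delta : R).

Let gauge U : \bar R := hausdorff_gauge d U.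

Lemma hausdorff_const_ge0 : (0 <= hausdorff_const R d)%R.
Proof. by rewrite /hausdorff_const !divr_ge0 ?Gamma_ge0 ?powR_ge0. Qed.

Lemma diam0 : diam (set0 : set 'cV[R]_n) = -oo.
Proof. by rewrite /diam setX0 image_set0 ereal_sup0. Qed.

Lemma le_diam U x y : U x -> U y -> (enorm (x - y))%:E <= diam U.
Proof. by move=> Ux Uy; apply: ereal_sup_ubound; exists (x, y). Qed.

Lemma diam_ge0 U : U !=set0 -> 0 <= diam U.
Proof.
by move=> [x Ux]; apply: le_trans (le_diam Ux Ux); rewrite lee_fin sqrtr_ge0.
Qed.

Lemma gauge_set0 : gauge set0 = 0.
Proof. by rewrite /gauge /hausdorff_gauge eqxx. Qed.

Lemma gauge_ge0 U : 0 <= gauge U.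
Proof.
rewrite /gauge /hausdorff_gauge; case: ifPn => // /set0P U0.
by rewrite mule_ge0 ?lee_fin ?hausdorff_const_ge0// expe_ge0// diam_ge0.
Qed.

Let discrete := g_sigma_algebraType [set: set 'cV[R]_n].

Let gauge_delta delta (U : set discrete) : \bar R :=
  if diam U <= delta%:E then gauge U else +oo.

Let gauge_delta0 delta : gauge_delta delta set0 = 0.
Proof. by rewrite /gauge_delta diam0 leNye gauge_set0. Qed.

Let gauge_delta_ge0 delta (U : set discrete) : 0 <= gauge_delta delta U.
Proof. by rewrite /gauge_delta; case: ifPn => // _; exact: gauge_ge0. Qed.

Let hausdorff_deltaE delta :
  @hausdorff_delta R d n delta = mu_ext (gauge_delta delta).
Proof.
apply/funext => A; apply/eqP; rewrite eq_le; apply/andP; split.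
- apply: le_ereal_inf_tmp => _ [F [_ AF] <-].
  have [Fd|/existsNP[k /negP Fk]] := pselect (forall k, diam (F k) <= delta%:E).
    apply: ereal_inf_lbound; exists F => //.
    by apply: eq_eseriesr => k _; rewrite /gauge_delta Fd.
  rewrite (@nneseries_pinfty _ _ xpredT k) ?leey//.
  by rewrite /gauge_delta (negbTE Fk).
- apply: le_ereal_inf_tmp => _ [F [AF Fd] <-]; apply: ereal_inf_lbound.
  exists F => /=.
    by split => // i; exact: sub_sigma_algebra.
  by apply: eq_eseriesr => k _; rewrite /gauge_delta Fd.
Qed.

Lemma hausdorff_delta0 delta : hausdorff_delta d delta (set0 : set 'cV[R]_n) = 0.
Proof. by rewrite hausdorff_deltaE mu_ext0. Qed.

Lemma hausdorff_delta_ge0 delta A : 0 <= hausdorff_delta d delta A.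
Proof. by rewrite hausdorff_deltaE mu_ext_ge0. Qed.

Lemma le_hausdorff_delta delta A B : A `<=` B ->
  hausdorff_delta d delta A <= hausdorff_delta d delta B.
Proof. by move=> AB; rewrite hausdorff_deltaE; exact: le_mu_ext. Qed.

Lemma hausdorff_delta_sigma_subadditive delta :
  sigma_subadditive (@hausdorff_delta R d n delta).
Proof. rewrite hausdorff_deltaE.
exact: (mu_ext_sigma_subadditive (gauge_delta_ge0 delta)). Qed.

Lemma hausdorff_delta_nincr A (s t : R) : (s <= t)%R ->
  hausdorff_delta d t A <= hausdorff_delta d s A.
Proof.
move=> st; apply: le_ereal_inf => _ [F [AF Fd] <-]; exists F => //; split=> // k.
by rewrite (le_trans (Fd k))// lee_fin.
Qed.

Lemma hausdorff_delta_le delta A : (0 < delta)%R ->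
  hausdorff_delta d delta A <= hausdorff_measure d A.
Proof. by move=> delta0; apply: ereal_sup_ubound; exists delta. Qed.

Let hausdorff0 : hausdorff_measure d (set0 : set (borel_cV R n)) = 0.
Proof.
apply/eqP; rewrite eq_le; apply/andP; split.
  by apply: ge_ereal_sup => _ [e /= e0 <-]; rewrite hausdorff_delta0.
by apply: le_trans (hausdorff_delta_le _ ltr01); rewrite hausdorff_delta0.
Qed.

Let hausdorff_ge0 (A : set (borel_cV R n)) : 0 <= hausdorff_measure d A.
Proof.
by apply: le_trans (hausdorff_delta_le _ ltr01); rewrite hausdorff_delta_ge0.
Qed.

Let le_hausdorff : {homo @hausdorff_measure R d n : A B / A `<=` B >-> A <= B}.
Proof.
move=> A B AB; apply: ge_ereal_sup => _ [e /= e0 <-].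
by apply: le_trans (hausdorff_delta_le _ e0); exact: le_hausdorff_delta.
Qed.

Let hausdorff_sigma_subadditive : sigma_subadditive (@hausdorff_measure R d n).
Proof.
move=> F; apply: ge_ereal_sup => _ [e /= e0 <-].
apply: le_trans (@hausdorff_delta_sigma_subadditive e F) _.
apply: lee_nneseries => [k _ _|k _]; first exact: hausdorff_delta_ge0.
exact: hausdorff_delta_le.
Qed.

HB.instance Definition _ := isOuterMeasure.Build R (borel_cV R n)
  (@hausdorff_measure R d n) hausdorff0 hausdorff_ge0 le_hausdorff
  hausdorff_sigma_subadditive.

Lemma hausdorff_measure_metric A B (e : R) : (0 < e)%R ->
    (forall x y, A x -> B y -> (e <= enorm (x - y))%R) ->
  hausdorff_measure d A + hausdorff_measure d B <= hausdorff_measure d (A `|` B).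
Proof.
move=> e0 AB.
pose H A t := hausdorff_delta d t A.
have key t : (0 < t)%R -> (t < e)%R -> H A t + H B t <= H (A `|` B) t.
  move=> t0 te; apply: le_ereal_inf_tmp => _ [F [ABF Fd] <-].
  pose G X k := if F k `&` X == set0 then set0 else F k.
  have GX X : X `<=` \bigcup_k F k -> X `<=` \bigcup_k G X k.
    move=> XF x Xx; have [k _ Fkx] := XF x Xx; exists k => //; rewrite /G.
    by case: ifPn => // /eqP FX; rewrite -FX.
  have Gd X k : diam (G X k) <= t%:E.
    by rewrite /G; case: ifPn => // _; rewrite diam0 leNye.
  have HG X : X `<=` \bigcup_k F k -> H X t <= \sum_(k <oo) gauge (G X k).
    by move=> XF; apply: ereal_inf_lbound; exists (G X) => //; split => //; exact: GX.
  have /HG HA : A `<=` \bigcup_k F k by move=> x Ax; apply: ABF; left.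
  have /HG HB : B `<=` \bigcup_k F k by move=> x Bx; apply: ABF; right.
  apply: le_trans (leeD HA HB) _.
  rewrite -nneseriesD; [|by move=> *; exact: gauge_ge0..].
  apply: lee_nneseries => [k _ _|k _]; first by rewrite adde_ge0// gauge_ge0.
  rewrite /G; case: ifPn => [_|/set0P[x [Fx Ax]]].
    by rewrite gauge_set0 add0e; case: ifPn => // _; rewrite gauge_set0 gauge_ge0.
  case: ifPn => [_|/set0P[y [Fy By]]]; first by rewrite gauge_set0 adde0.
  have := le_trans (le_diam Fx Fy) (Fd k).
  by rewrite lee_fin leNgt (lt_le_trans te)// AB.
have small s t : (0 < s)%R -> (0 < t)%R ->
    H A s + H B t <= hausdorff_measure d (A `|` B).
  move=> s0 t0; pose r := Num.min (Num.min s t) (e / 2)%R.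
  have r0 : (0 < r)%R by rewrite !lt_min s0 t0 divr_gt0.
  apply: le_trans (hausdorff_delta_le _ r0).
  apply: le_trans (key _ r0 _); last first.
    by rewrite !gt_min [X in _ || X](_ : _ = true) ?orbT// ltr_pdivrMr// ltr_pMr// ltr1n.
  apply: leeD; apply: hausdorff_delta_nincr; rewrite !ge_min ?lexx ?orbT//.
have [BA|] := eqVneq (hausdorff_measure d B) +oo.
  have <- : +oo = hausdorff_measure d (A `|` B).
    by apply/eqP; rewrite eq_sym -leye_eq -BA le_outer_measure//; right.
  exact: leey.
rewrite -ltey => Boo.
have Bfin : hausdorff_measure d B \is a fin_num by rewrite ge0_fin_numE.
rewrite -leeBrDr//; apply: ge_ereal_sup => _ [s /= s0 <-].
rewrite leeBrDr// addeC.
have [AA|] := eqVneq (hausdorff_measure d A) +oo.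
  have <- : +oo = hausdorff_measure d (A `|` B).
    by apply/eqP; rewrite eq_sym -leye_eq -AA le_outer_measure//; left.
  exact: leey.
rewrite -ltey => Aoo.
have Afin : H A s \is a fin_num.
  rewrite ge0_fin_numE ?hausdorff_delta_ge0//.
  by rewrite (le_lt_trans _ Aoo)// hausdorff_delta_le.
rewrite -leeBrDr//; apply: ge_ereal_sup => _ [t /= t0 <-].
by rewrite leeBrDr// addeC; exact: small.
Qed.

Lemma mx_norm_le_enorm (x : 'cV[R]_n) : (`|x| <= enorm x)%R.
Proof.
rewrite [leLHS]mx_normrE.
apply: (big_ind (fun r => r <= enorm x)%R) => [|a b ha hb|[i j] _].
- exact: sqrtr_ge0.
- by rewrite ge_max ha.
- rewrite /= -sqrtr_sqr ler_wsqrtr// (bigD1 i)//= (ord1 j) lerDl.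
  by apply: sumr_ge0 => k _; rewrite sqr_ge0.
Qed.

Section closed_caratheodory.
Variables (C X : set 'cV[R]_n).
Hypotheses (closedC : closed C) (Xoo : hausdorff_measure d X < +oo).

Let far k : set 'cV[R]_n :=
  [set x | X x /\ forall c, C c -> (k.+1%:R^-1 <= `|x - c|)%R].

Let ring k := far k.+1 `\` far k.

Let h k := hausdorff_measure d (far k).
Let a k := hausdorff_measure d (ring k).

Let farS k m : (k <= m)%N -> far k `<=` far m.
Proof.
move=> km x [Xx xC]; split=> // c Cc; apply: le_trans (xC c Cc).
by rewrite lef_pV2 ?posrE ?ltr0n// ler_nat ltnS.
Qed.

Let far_sep k x y : far k x -> X y -> ~ far k.+1 y ->
  (k.+1%:R^-1 - k.+2%:R^-1 <= enorm (x - y))%R.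
Proof.
move=> [_ xC] Xy yC; apply: le_trans (mx_norm_le_enorm _).
have [c [Cc cy]] : exists c, C c /\ (`|y - c| < k.+2%:R^-1)%R.
  apply: contrapT => /forallNP yc; apply: yC; split=> // c Cc.
  by rewrite leNgt; apply/negP => ?; apply: (yc c).
rewrite lerBlDr (le_trans (xC c Cc))//.
rewrite (_ : x - c = (x - y) + (y - c))%R; last by rewrite addrA subrK.
by rewrite (le_trans (ler_normD _ _))// lerD2l ltW.
Qed.

Let sep_gt0 k : (0 < k.+1%:R^-1 - k.+2%:R^-1 :> R)%R.
Proof. by rewrite subr_gt0 ltf_pV2 ?posrE ?ltr0n// ltr_nat. Qed.

Let h_step k : h k.+1 + a k.+2 <= h k.+3.
Proof.
apply: le_trans (hausdorff_measure_metric (sep_gt0 k.+1) _) _.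
  by move=> x y fx [[Xy _] nfy]; exact: far_sep.
apply: le_outer_measure => x [fx|[]//].
by apply: farS fx; rewrite !ltnS ltnW.
Qed.

Let h_le k : h k <= hausdorff_measure d X.
Proof. by apply: le_outer_measure => x []. Qed.

Let sum_ring m : \sum_(0 <= k < m) a k.+2 <= h m.+1 + h m.+2.
Proof.
elim: m => [|m ih].
  by rewrite big_geq// adde_ge0//; exact: hausdorff_ge0.
rewrite big_nat_recr//= (le_trans (leeD2r _ ih))//.
by rewrite addeAC addeC leeD2l.
Qed.

Let ring_summable : \sum_(0 <= k <oo) a k < +oo.
Proof.
have a0 k : 0 <= a k by exact: outer_measure_ge0.
have afin k : a k < +oo.
  by apply: le_lt_trans Xoo; apply: le_outer_measure => x [[]].
rewrite (nneseries_split _ 2)//; rewrite lte_add_pinfty//.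
  by rewrite lte_sum_pinfty.
rewrite -nneseries_addn//.
apply: (@le_lt_trans _ _ (hausdorff_measure d X + hausdorff_measure d X)); last first.
  by rewrite lte_add_pinfty.
apply: lime_le; first by apply: is_cvg_nneseries => k _ _; exact: a0.
apply: nearW => m; under eq_bigr do rewrite addnC.
by rewrite (le_trans (sum_ring m))// leeD.
Qed.

Let far_cover m : X `\` C `<=` far m `|` \bigcup_(k in ~` `I_m) ring k.
Proof.
move=> x [Xx nCx].
have [k fk] : exists k, far k x.
  have /nbhs_ballP[e /= e0 xe] : nbhs x (~` C).
    by apply: open_nbhs_nbhs; split => //; exact: closed_openC.
  exists (Num.truncn e^-1); split=> // c Cc; rewrite leNgt; apply/negP => xc.
  apply: (xe c) => //; rewrite -ball_normE /ball_/=.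
  rewrite (lt_le_trans xc)// invf_ple ?posrE ?ltr0n//.
  by rewrite ltW// truncnS_gt.
have [|nfm] := pselect (far m x); [by left|right].
have [j [mj fj nfj]] : exists j, [/\ (m <= j)%N, far j.+1 x & ~ far j x].
  apply: contrapT => /forallNP nj.
  have nf i : ~ far (m + i)%N x.
    elim: i => [|i ih]; first by rewrite addn0.
    by rewrite addnS => fi; apply: (nj (m + i)%N); split=> //; exact: leq_addr.
  by apply: (nf k); apply: farS fk; exact: leq_addl.
by exists j => //=; apply/negP; rewrite -leqNgt.
Qed.

Lemma closed_caratheodory_le :
  hausdorff_measure d (X `&` C) + hausdorff_measure d (X `&` ~` C) <=
  hausdorff_measure d X.
Proof.
have a0 k : 0 <= a k by exact: outer_measure_ge0.
have tail m : hausdorff_measure d (X `&` C) + hausdorff_measure d (X `&` ~` C) <=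
    hausdorff_measure d X + \sum_(m <= k <oo) a k.
  have : hausdorff_measure d (X `&` ~` C) <= h m + \sum_(m <= k <oo) a k.
    apply: le_trans (le_outer_measure _ _ _ (@far_cover m)) _.
    apply: le_trans (outer_measureU2 _ _ _) _; rewrite leeD2l//.
    exact: outer_measure_sigma_subadditive_tail.
  move=> /(leeD2l (hausdorff_measure d (X `&` C))) /le_trans; apply.
  rewrite addeA leeD2r//.
  apply: le_trans (hausdorff_measure_metric (e := m.+1%:R^-1) _ _) _.
  - by rewrite invr_gt0.
  - move=> x y [_ Cx] [_ /(_ x Cx)] /le_trans; apply.
    by rewrite distrC mx_norm_le_enorm.
  - by apply: le_outer_measure => x [[]|[]].
have := nneseries_tail_cvg ring_summable (fun k _ => a0 k).
move=> lim0; have := cvgeD _ (cvg_cst (hausdorff_measure d X)) lim0.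
rewrite adde0 fin_num_adde_defl// => limX.
by apply: (cvge_ge _ (limX _ isT _)); exact: nearW.
Qed.

End closed_caratheodory.

Lemma borel_caratheodory (A : set (borel_cV R n)) :
  measurable A -> (@hausdorff_measure R d n).-caratheodory A.
Proof.
move: A; apply: smallest_sub.
  split.
  - exact: caratheodory_measurable_set0.
  - by move=> A mA; rewrite setTD; exact: caratheodory_measurable_setC.
  - exact: caratheodory_measurable_bigcup.
move=> U openU; rewrite -(setCK U); apply: caratheodory_measurable_setC.
apply: le_caratheodory_measurable => X.
have [Xoo|] := eqVneq (hausdorff_measure d X) +oo.
  by apply: le_trans (leey _) _; rewrite -Xoo.
by rewrite -ltey => Xoo; apply: closed_caratheodory_le => //; exact: open_closedC.
Qed.

Let hausdorff_sigma_additive :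
  semi_sigma_additive (@hausdorff_measure R d n : set (borel_cV R n) -> \bar R).
Proof.
move=> F mF tF mUF; apply: caratheodory_measure_sigma_additive => //.
- by move=> k; exact: borel_caratheodory.
- exact: borel_caratheodory.
Qed.

HB.instance Definition _ := isMeasure.Build _ (borel_cV R n) R
  (@hausdorff_measure R d n) hausdorff0 hausdorff_ge0 hausdorff_sigma_additive.

End hausdorff_measure_is_measure.

Section cauchy_and_moebius.
Variables (R : realType) (d : nat).
Implicit Types (phi psi y : 'cV[R]_d.+1).

Definition cstar_density phi y : R :=
  Gamma (d.+1%:R / 2) / (2 * pi `^ (d.+1%:R / 2)) *
  (`|1 - enorm phi ^+ 2| / enorm (y - phi) ^+ 2) ^+ d.

(* Surface area on the sphere is hausdorff_measure d restricted to it. *)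
Definition cstar_distributed disp (T : measurableType disp)
    (P : probability T R) (Y : {RV P >-> borel_cV R d.+1}) phi : Prop :=
  (forall w, sphere d (Y w)) /\
  forall B : set (borel_cV R d.+1), measurable B ->
    distribution P Y B =
    (\int[hausdorff_measure d]_(y in B `&` sphere d) (cstar_density phi y)%:E)%E.

Definition moebius (A : 'M[R]_d.+1) psi y : 'cV[R]_d.+1 :=
  A *m (((1 - enorm psi ^+ 2) / enorm (y + psi) ^+ 2) *: (y + psi) + psi).

End cauchy_and_moebius.

Arguments cstar_distributed {R d disp T} P Y phi.

(* Main.v *)
Require Import Defs.
From mathcomp Require Import all_boot all_order all_algebra.
From mathcomp Require Import all_classical all_reals all_analysis.
From mathcomp Require Import measurable_realfun ring lra.

(* For psi off the sphere, M_psi = M_{I,psi} is a bijection of the sphere with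
   inverse M_{-psi}, and
     |M_psi x - M_psi y|^2 = lam(x) lam(y) |x - y|^2,
     lam(y) = |1 - |psi|^2| / |y + psi|^2.
   On a subset of the sphere where a <= lam <= b, M_psi is thus b-Lipschitz and
   its inverse is a^-1-Lipschitz, so it multiplies d-dimensional Hausdorff
   measure by a factor between a^d and b^d; cutting a set into slices on which
   lam is nearly constant gives H(M_psi E) = \int_E lam^d dH.  With psi = - phi
   the density of Y is a constant times lam^d, hence M_{I,-phi}(Y) has constant
   density on the sphere, whatever phi is.  Neither the value of the constant
   nor that of H(S^d) is needed. *)

Set Implicit Arguments.
Unset Strict Implicit.
Unset Printing Implicit Defensive.
Import Order.TTheory GRing.Theory Num.Theory.
Import numFieldNormedType.Exports.
Local Open Scope classical_set_scope.
Local Open Scope ring_scope.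

(** * Algebra of the Euclidean norm *)

Section euclidean_norm.
Variables (R : realType) (n : nat).
Implicit Types (x y u v : 'cV[R]_n) (a b : R).

Lemma enorm_ge0 x : 0 <= enorm x.
Proof. exact: sqrtr_ge0. Qed.

Lemma enorm_sqr x : enorm x ^+ 2 = \sum_(i < n) x i 0 ^+ 2.
Proof. by rewrite sqr_sqrtr// sumr_ge0// => i _; exact: sqr_ge0. Qed.

Lemma enorm_eq0 x : (enorm x ^+ 2 == 0) = (x == 0).
Proof.
apply/eqP/eqP => [|->]; last first.
  by rewrite enorm_sqr big1// => i _; rewrite mxE expr0n.
rewrite enorm_sqr => /psumr_eq0P x0; apply/colP => i; rewrite mxE.
by apply/eqP; rewrite -sqrf_eq0 x0// => j _; exact: sqr_ge0.
Qed.

Lemma enormN x : enorm (- x) = enorm x.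
Proof. by congr Num.sqrt; apply: eq_bigr => i _; rewrite mxE sqrrN. Qed.

(** The inner product stays a bare sum, which later proofs treat as an opaque scalar for [lra],
    [ring] and [field]. *)
Lemma enorm_sqr_lin a b u v : enorm (a *: u + b *: v) ^+ 2 =
  a ^+ 2 * enorm u ^+ 2 + 2 * a * b * (\sum_(i < n) u i 0 * v i 0) +
  b ^+ 2 * enorm v ^+ 2.
Proof.
rewrite !enorm_sqr !mulr_sumr -!big_split/=; apply: eq_bigr => i _.
by rewrite !mxE; ring.
Qed.

Lemma enorm_sqrZ a u : enorm (a *: u) ^+ 2 = a ^+ 2 * enorm u ^+ 2.
Proof. by have := enorm_sqr_lin a 0 u u; rewrite scale0r addr0 => ->; ring. Qed.

Lemma enorm_sqrB u v : enorm (u - v) ^+ 2 =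
  enorm u ^+ 2 - 2 * (\sum_(i < n) u i 0 * v i 0) + enorm v ^+ 2.
Proof.
by have := enorm_sqr_lin 1 (-1) u v; rewrite scale1r scaleN1r => ->; ring.
Qed.

End euclidean_norm.

(** * The maps [M_psi] on the sphere: invariance, inverse and distortion of distances *)

Section conformal.
Variables (R : realType) (d : nat).
Implicit Types (psi x y : 'cV[R]_d.+1).

Lemma moebius_mul (A : 'M[R]_d.+1) psi y :
  moebius A psi y = A *m moebius 1%:M psi y.
Proof. by rewrite /moebius mul1mx. Qed.

Definition conformal_factor psi y : R :=
  `|1 - enorm psi ^+ 2| / enorm (y + psi) ^+ 2.

Section off_sphere.
Variable psi : 'cV[R]_d.+1.
Hypothesis psi_off : ~ sphere d psi.

Lemma sphere_addr_neq0 y : sphere d y -> enorm (y + psi) ^+ 2 != 0.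
Proof.
move=> Sy; rewrite enorm_eq0 addr_eq0; apply/eqP => ypsi.
by apply: psi_off; rewrite /sphere/= -enormN -ypsi.
Qed.

Lemma one_sub_enorm_neq0 : 1 - enorm psi ^+ 2 != 0.
Proof.
rewrite subr_eq0 eq_sym sqrf_eq1; apply/negP => /orP[/eqP//|/eqP psi1].
by have := enorm_ge0 psi; rewrite psi1 oppr_ge0 ler10.
Qed.

Lemma conformal_factor_gt0 y : sphere d y -> 0 < conformal_factor psi y.
Proof.
move=> Sy; rewrite divr_gt0 ?normr_gt0 ?one_sub_enorm_neq0//.
by rewrite lt_def sphere_addr_neq0//= sqr_ge0.
Qed.

(** With [u = y + psi], [q = |u|^2], [p = |psi|^2], [s = <u, psi>] and [k = 1 - p], the image has
    squared norm [k^2 / q + 2 k s / q + p]. Since [|y| = 1] gives [2 s = q - k], this equals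
    [k + p = 1]. *)
Lemma moebius_sphere y : sphere d y -> sphere d (moebius 1%:M psi y).
Proof.
move=> Sy; suff /eqP : enorm (moebius 1%:M psi y) ^+ 2 = 1.
  rewrite sqrf_eq1 => /orP[/eqP//|/eqP m1].
  by have := enorm_ge0 (moebius 1%:M psi y); rewrite m1 oppr_ge0 ler10.
have q0 := sphere_addr_neq0 Sy.
have := enorm_sqrB (y + psi) psi; rewrite addrK Sy expr1n.
rewrite /moebius mul1mx -[X in _ *: _ + X]scale1r enorm_sqr_lin.
set q := enorm (y + psi) ^+ 2 in q0 *; set p := enorm psi ^+ 2.
set s := \sum_(i < _) _ => pqs.
have -> : p = 1 - q + 2 * s by lra.
by field.
Qed.

(** [M_psi y - psi] is [(k / q) u], of squared norm [k^2 / q]; applying [M_{-psi}] therefore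
    rescales it by [q / k], which gives back [u = y + psi]. *)
Lemma moebiusK y : sphere d y ->
  moebius 1%:M (- psi) (moebius 1%:M psi y) = y.
Proof.
move=> Sy; rewrite /moebius !mul1mx addrK enormN enorm_sqrZ scalerA.
have q0 := sphere_addr_neq0 Sy; have k0 := one_sub_enorm_neq0.
set q := enorm (y + psi) ^+ 2 in q0 *; set k := 1 - _ in k0 *.
have -> : k / ((k / q) ^+ 2 * q) * (k / q) = 1 by field; rewrite k0 q0.
by rewrite scale1r addrK.
Qed.

(** The translation by [psi] cancels in the difference, leaving the inversion [u |-> k u / |u|^2],
    for which [|u / |u|^2 - v / |v|^2|^2 = |u - v|^2 / (|u|^2 |v|^2)]. *)
Lemma enorm_moebiusB x y : sphere d x -> sphere d y ->
  enorm (moebius 1%:M psi x - moebius 1%:M psi y) ^+ 2 =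
  conformal_factor psi x * conformal_factor psi y * enorm (x - y) ^+ 2.
Proof.
move=> Sx Sy; rewrite /moebius !mul1mx opprD addrACA subrr addr0.
rewrite -(scaleNr _ (y + psi)) enorm_sqr_lin.
have -> : x - y = (x + psi) - (y + psi) by rewrite opprD addrACA subrr addr0.
rewrite enorm_sqrB /conformal_factor.
have p0 := sphere_addr_neq0 Sx; have q0 := sphere_addr_neq0 Sy.
set k := 1 - _; set p := enorm (x + psi) ^+ 2 in p0 *.
set q := enorm (y + psi) ^+ 2 in q0 *.
rewrite [X in _ = X * _]mulrACA -normrM ger0_norm -?expr2 ?sqr_ge0//.
by field; rewrite p0 q0.
Qed.

End off_sphere.
End conformal.

(** * Hausdorff measure under a Lipschitz map *)

Section hausdorff_lipschitz.
Variables (R : realType) (d n m : nat) (f : 'cV[R]_n -> 'cV[R]_m) (L : R).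
Variable E : set 'cV[R]_n.
Hypotheses (L_gt0 : 0 < L)
  (f_lip : forall x y, E x -> E y -> enorm (f x - f y) <= L * enorm (x - y)).
Local Open Scope ereal_scope.

(** The bound [f_lip] holds only on [E], so covering sets are cut down to [E] before they are
    mapped. *)
Let fcut (U : set 'cV[R]_n) := f @` (U `&` E).

Lemma diam_lipschitz U : diam (fcut U) <= L%:E * diam U.
Proof.
apply: ge_ereal_sup => _ [[_ _] [[x [Ux Ex] <-] [y [Uy Ey] <-]] <-].
apply: (@le_trans _ _ (L%:E * (enorm (x - y))%:E)).
  by rewrite -EFinM lee_fin f_lip.
by rewrite lee_pmul2l// le_diam.
Qed.

Lemma hausdorff_gauge_lipschitz U :
  hausdorff_gauge d (fcut U) <= (L ^+ d)%:E * hausdorff_gauge d U.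
Proof.
rewrite {1}/hausdorff_gauge; case: ifPn => [_|/set0P fU0].
  by rewrite mule_ge0 ?lee_fin ?exprn_ge0 ?gauge_ge0// ltW.
(* Nonemptiness makes both diameters nonnegative ([diam set0] is [-oo]), so that taking powers
   preserves their order. *)
have U0 : U !=set0 by case: fU0 => _ [x [Ux _] _]; exists x.
rewrite /hausdorff_gauge ifF; last exact/negbTE/set0P.
rewrite muleCA lee_wpmul2l ?lee_fin ?hausdorff_const_ge0//.
have := diam_lipschitz U; have := diam_ge0 fU0; have := diam_ge0 U0.
move: (diam U) (diam _) => a b a0 b0 ba.
elim: d => [|k ih]; first by rewrite !expe0 mule1.
by rewrite !expeS exprS EFinM muleACA lee_pmul// expe_ge0.
Qed.

Lemma hausdorff_measure_lipschitz :
  hausdorff_measure d (f @` E) <= (L ^+ d)%:E * hausdorff_measure d E.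
Proof.
have Ld0 : (0 < L ^+ d)%R by rewrite exprn_gt0.
apply: ge_ereal_sup => _ [e /= e0 <-].
(* A cover by sets of diameter at most [e / L] is mapped to one by sets of diameter at most [e]. *)
have eL0 : (0 < e / L)%R by rewrite divr_gt0.
apply: (@le_trans _ _ ((L ^+ d)%:E * hausdorff_delta d (e / L) E)); last first.
  by rewrite lee_pmul2l// hausdorff_delta_le.
rewrite -ereal_inf_pZl//; apply: le_ereal_inf_tmp => _ [_ [F [EF Fd] <-] <-].
apply: (@le_trans _ _ (\sum_(k <oo) hausdorff_gauge d (fcut (F k)))).
  apply: ereal_inf_lbound; exists (fun k => fcut (F k)) => //; split.
    move=> _ [x Ex <-]; have [k _ Fx] := EF x Ex.
    by exists k => //; exists x.
  move=> k; apply: le_trans (diam_lipschitz _) _.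
  have -> : e%:E = L%:E * (e / L)%:E by rewrite -EFinM mulrC divfK// gt_eqF.
  by rewrite lee_pmul2l.
rewrite -nneseriesZl; last by move=> k _; exact: gauge_ge0.
apply: lee_nneseries => [k _ _|k _]; first exact: gauge_ge0.
exact: hausdorff_gauge_lipschitz.
Qed.

End hausdorff_lipschitz.

(** * Borel measurability of the maps and of the sphere *)

Section borel_functions.
Variable R : realType.

(** Every neighbourhood of a matrix contains a finite product of neighbourhoods of its entries. *)
Lemma continuous_mx (T : topologicalType) m n (f : T -> 'M[R]_(m, n)) x :
  (forall i j, {for x, continuous (fun y => f y i j)}) -> {for x, continuous f}.
Proof.
move=> cf A [P Px PA].
apply: (filterS (P := [set y | forall i j, P i j (f y i j)])).
  by move=> y Py; apply: PA.
by apply: filter_forall => i; apply: filter_forall => j; exact: cf.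
Qed.

(** Meant for [moebius] and [conformal_factor], whose denominator vanishes at [- psi]. The preimage
    splits into its part in [[set p]], which is that singleton or empty, and its part off [p], which
    is open. *)
Lemma borel_preimage_open n (U : topologicalType) (f : 'cV[R]_n -> U) p O :
  (forall x, x != p -> {for x, continuous f}) -> open O ->
  measurable (f @^-1` O : set (borel_cV R n)).
Proof.
move=> cf oO; have cp : closed [set p].
  apply: accessible_closed_set1; apply: hausdorff_accessible.
  exact: norm_hausdorff.
have mp : measurable ([set p] : set (borel_cV R n)).
  rewrite -[X in measurable X]setCK; apply: measurableC.
  by apply: sub_sigma_algebra; exact: closed_openC.
rewrite -[X in measurable X](setUIDK _ [set p]); apply: measurableU.
  have [pO|npO] := pselect (O (f p)).
    by rewrite (_ : _ `&` _ = [set p]) //; apply/seteqP; split => [x []|x ->].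
  rewrite (_ : _ `&` _ = set0)//; apply/seteqP; split => [x [fx xp]|//].
  by apply: npO; rewrite -xp.
apply: sub_sigma_algebra => /=; rewrite openE => x [Ox xp]; apply: filterI.
  by apply: cf => //; [exact/eqP|exact: open_nbhs_nbhs].
by apply: open_nbhs_nbhs; split => //; exact: closed_openC.
Qed.

Lemma measurable_fun_off_point_cV n m (f : borel_cV R n -> borel_cV R m) p :
  (forall x, x != p -> {for x, continuous (f : 'cV[R]_n -> 'cV[R]_m)}) ->
  measurable_fun [set: borel_cV R n] f.
Proof.
move=> cf; apply: (@measurability _ _ _ (borel_cV R m) _ _ (@open _)) => //.
move=> _ [B oB <-].
by rewrite setTI; exact: borel_preimage_open cf oB.
Qed.

Lemma measurable_fun_off_point n (f : borel_cV R n -> R) p :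
  (forall x, x != p -> {for x, continuous (f : 'cV[R]_n -> R)}) ->
  measurable_fun [set: borel_cV R n] f.
Proof.
move=> cf; apply: (measurability _ (RGenOpens.measurableE R)).
move=> _ [_ [a [b ->]] <-]; rewrite setTI.
by apply: borel_preimage_open cf _; exact: interval_open.
Qed.

Lemma cvg_enorm_sqr n (T : Type) (F : set_system T) {FF : Filter F}
    (f : T -> 'cV[R]_n) x :
  f t @[t --> F] --> x -> enorm (f t) ^+ 2 @[t --> F] --> enorm x ^+ 2.
Proof.
move=> fx; rewrite enorm_sqr; under eq_fun do rewrite enorm_sqr.
apply: cvg_big => [|i _]; first exact: add_continuous.
have fxi : f t i 0 @[t --> F] --> x i 0.
  exact: (cvg_comp f (fun M : 'cV[R]_n => M i 0) fx
    (@coord_continuous _ _ _ i 0 x)).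
exact: (cvgM fxi fxi).
Qed.

Section moebius_cvg.
Variables (d : nat) (psi x : 'cV[R]_d.+1) (T : Type) (F : set_system T).
Context {FF : Filter F}.
Variable f : T -> 'cV[R]_d.+1.
Hypotheses (fx : f t @[t --> F] --> x) (x_psi : x != - psi).

Let f_add : f t + psi @[t --> F] --> x + psi.
Proof. by apply: cvgD => //; exact: cvg_cst. Qed.

Let divr_cvg (r : R) :
  r / enorm (f t + psi) ^+ 2 @[t --> F] --> r / enorm (x + psi) ^+ 2.
Proof.
apply: cvgM; first exact: cvg_cst.
by apply: cvgV; [rewrite enorm_eq0 addr_eq0|exact: cvg_enorm_sqr].
Qed.

Lemma cvg_conformal_factor :
  conformal_factor psi (f t) @[t --> F] --> conformal_factor psi x.
Proof. exact: divr_cvg. Qed.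

Lemma cvg_moebius1 : moebius 1%:M psi (f t) @[t --> F] --> moebius 1%:M psi x.
Proof.
rewrite /moebius mul1mx; under eq_fun do rewrite mul1mx.
by apply: cvgD; [exact: cvgZ|exact: cvg_cst].
Qed.

Lemma cvg_moebius_coord A i j :
  moebius A psi (f t) i j @[t --> F] --> moebius A psi x i j.
Proof.
rewrite moebius_mul mxE; under eq_fun do rewrite moebius_mul mxE.
apply: cvg_big => [|k _]; first exact: add_continuous.
apply: cvgM; first exact: cvg_cst.
exact: (cvg_comp _ (fun M : 'cV[R]_d.+1 => M k j) cvg_moebius1
  (@coord_continuous _ _ _ k j _)).
Qed.

End moebius_cvg.

Lemma measurable_moebius d A (psi : 'cV[R]_d.+1) :
  measurable_fun setT (moebius A psi : borel_cV R d.+1 -> borel_cV R d.+1).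
Proof.
apply: (@measurable_fun_off_point_cV _ _ _ (- psi)) => x xpsi.
apply: continuous_mx => i j.
exact: (cvg_moebius_coord (@cvg_id _ (nbhs x))).
Qed.

Lemma measurable_conformal_factor d (psi : 'cV[R]_d.+1) :
  measurable_fun setT (conformal_factor psi : borel_cV R d.+1 -> R).
Proof.
apply: (@measurable_fun_off_point _ _ (- psi)) => x xpsi.
exact: (cvg_conformal_factor (@cvg_id _ (nbhs x))).
Qed.

Lemma measurable_sphere d : measurable (sphere d : set (borel_cV R d.+1)).
Proof.
have -> : sphere d = ~` ((fun x : 'cV[R]_d.+1 => enorm x ^+ 2) @^-1` [set~ 1]).
  apply/seteqP; split=> [x Sx|x].
    by apply; rewrite /= Sx expr1n.
  move=> /contrapT /= /eqP; rewrite sqrf_eq1 => /orP[/eqP//|/eqP x1].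
  by have := enorm_ge0 x; rewrite x1 oppr_ge0 ler10.
(* The squared norm is continuous everywhere, so the exceptional point [0] is an arbitrary
   choice. *)
apply: measurableC; apply: (@borel_preimage_open _ _ _ 0).
  by move=> x _; exact: (cvg_enorm_sqr (@cvg_id _ (nbhs x))).
by apply: closed_openC; exact: closed_eq.
Qed.

End borel_functions.

(** * Identifying an integral from two-sided bounds on slices *)

Section integral_sandwich.
Local Open Scope ereal_scope.
Context disp (T : measurableType disp) (R : realType).
Variables (mu nu : {measure set T -> \bar R}) (g : T -> R) (E : set T) (c : R).
Hypotheses (mE : measurable E) (mg : measurable_fun E g) (c_gt0 : (0 < c)%R).
Hypothesis g_ge : forall x, E x -> (c <= g x)%R.
Hypothesis sandwich : forall (F : set T) (a b : R), measurable F -> F `<=` E ->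
  (0 < a <= b)%R -> (forall x, F x -> (a <= g x <= b)%R) ->
  a%:E * mu F <= nu F <= b%:E * mu F.

(* On the slice lo_k <= g < lo_k+1, lo_k = c + k (t - 1) c, both sides lie
   between lo_k mu and lo_k+1 mu, and lo_k+1 <= t lo_k because c <= lo_k. *)
Let sandwich_ratio (t : R) : (1 < t)%R ->
  nu E <= t%:E * \int[mu]_(x in E) (g x)%:E /\
  \int[mu]_(x in E) (g x)%:E <= t%:E * nu E.
Proof.
move=> t1; pose e := ((t - 1) * c)%R.
have e0 : (0 < e)%R by rewrite mulr_gt0// subr_gt0.
have t0 : (0 <= t)%R by rewrite ltW// (lt_trans _ t1).
pose lo k : R := (c + k%:R * e)%R.
pose F k := E `&` g @^-1` `[lo k, lo k.+1[%classic.
have mF k : measurable (F k) by exact: mg.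
have FE k : F k `<=` E by move=> x [].
have gF k x : F k x -> (lo k <= g x <= lo k.+1)%R.
  by move=> [_] /=; rewrite in_itv/= => /andP[-> /ltW].
have lo_gt0 k : (0 < lo k)%R by rewrite ltr_pwDl// mulr_ge0// ltW.
have lo_le k : (lo k <= lo k.+1)%R by rewrite lerD2l ler_pM2r// ler_nat.
have lo_ratio k : (lo k.+1 <= t * lo k)%R.
  (* This quantity is exactly [t * lo k - lo k.+1], because [e = (t - 1) * c]. *)
  have : (0 <= k%:R * e * (t - 1))%R.
    by rewrite !mulr_ge0 ?subr_ge0// ltW.
  by rewrite /lo -natr1 /e; lra.
have EF : E = \bigcup_k F k.
  apply/seteqP; split=> [x Ex|x [k _ []]//].
  exists (Num.truncn ((g x - c) / e)) => //; split => //=.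
  have : (0 <= (g x - c) / e)%R by rewrite divr_ge0 ?subr_ge0 ?g_ge// ltW.
  move=> /truncn_itv; rewrite in_itv/= ler_pdivlMr// ltr_pdivrMr//.
  by rewrite /lo -lerBrDl -ltrBlDl.
have tF : trivIset setT F.
  move=> i j _ _ [x [[_ /= +] [_ /= +]]].
  rewrite !in_itv/= => /andP[gi gi'] /andP[gj gj'].
  have lt_of k l : (lo k <= g x)%R -> (g x < lo l.+1)%R -> (k <= l)%N.
    move=> h1 h2; have := le_lt_trans h1 h2.
    by rewrite ltrD2l ltr_pM2r// ltr_nat ltnS.
  by apply/eqP; rewrite eqn_leq !lt_of.
have mgF k : measurable_fun (F k) (fun x => (g x)%:E).
  by apply/measurable_EFinP; exact: measurable_funS mg.
have int_ge k : (lo k)%:E * mu (F k) <= \int[mu]_(x in F k) (g x)%:E.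
  rewrite -integral_cst//; apply: ge0_le_integral => //=.
  - by move=> x _; rewrite lee_fin ltW.
  - by move=> x /gF/andP[]; rewrite lee_fin.
have int_le k : \int[mu]_(x in F k) (g x)%:E <= (lo k.+1)%:E * mu (F k).
  rewrite -integral_cst//; apply: ge0_le_integral => //=.
  - by move=> x /gF/andP[+ _]; rewrite lee_fin; apply: le_trans; exact: ltW.
  - by move=> x /gF/andP[]; rewrite lee_fin.
have sand k : (lo k)%:E * mu (F k) <= nu (F k) <= (lo k.+1)%:E * mu (F k).
  by apply: sandwich => //; [rewrite lo_gt0 lo_le|exact: gF].
have ratio k : (lo k.+1)%:E * mu (F k) <= t%:E * ((lo k)%:E * mu (F k)).
  by rewrite muleA -EFinM lee_wpmul2r// lee_fin.
have int_ge0 k : 0 <= \int[mu]_(x in F k) (g x)%:E.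
  by apply: le_trans (int_ge k); rewrite mule_ge0// lee_fin ltW.
have -> : nu E = \sum_(k <oo) nu (F k).
  rewrite {1}EF measure_bigcup//; apply: eq_eseriesl => k; exact: in_setT.
have -> : \int[mu]_(x in E) (g x)%:E =
    \sum_(k <oo) \int[mu]_(x in F k) (g x)%:E.
  rewrite {1}EF ge0_integral_bigcup//= -EF; first exact/measurable_EFinP.
  by move=> x /g_ge; rewrite lee_fin; apply: le_trans; exact: ltW.
split; rewrite -nneseriesZl//; apply: lee_nneseries => // k _.
  have /andP[_ /le_trans] := sand k; apply; apply: le_trans (ratio k) _.
  by rewrite lee_wpmul2l.
apply: (le_trans (int_le k)); apply: le_trans (ratio k) _.
by rewrite lee_wpmul2l//; have /andP[] := sand k.
Qed.

(** Letting [t] decrease to 1 in [sandwich_ratio] squeezes the two sides together. Comparing by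
    ratios rather than by differences also covers infinite values. *)
Lemma integral_sandwich : \int[mu]_(x in E) (g x)%:E = nu E.
Proof.
have int0 : 0 <= \int[mu]_(x in E) (g x)%:E.
  apply: integral_ge0 => x /g_ge; rewrite lee_fin; apply: le_trans.
  exact: ltW.
have scale (r : R) (a b : \bar R) : (0 < r < 1)%R ->
    a <= r^-1%:E * b -> r%:E * a <= b.
  move=> /andP[r0 r1] /(lee_wpmul2l (ltW r0 : 0 <= r%:E)).
  by rewrite muleA -EFinM divff ?mul1e// gt_eqF.
have inv1 (r : R) : (0 < r < 1)%R -> (1 < r^-1)%R.
  by move=> /andP[r0 r1]; rewrite invf_gt1.
(* It suffices to compare after scaling one side by any [r] in []0, 1[]; the ratio used is
   [t = r^-1]. *)
apply/eqP; rewrite eq_le; apply/andP; split; apply/lee_mul01Pr => // r r01;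
  by apply: scale => //; have [] := sandwich_ratio (inv1 _ r01).
Qed.

End integral_sandwich.

(** * Change of variables for [M_psi] on the sphere *)

Section change_of_variables.
Variables (R : realType) (d : nat) (psi : 'cV[R]_d.+1).
Hypothesis psi_off : ~ sphere d psi.

Let opp_off : ~ sphere d (- psi).
Proof. by rewrite /sphere/= enormN. Qed.

Let moebiusNK y : sphere d y -> moebius 1%:M psi (moebius 1%:M (- psi) y) = y.
Proof. by move=> Sy; rewrite -{1}[psi]opprK moebiusK. Qed.

(** As a preimage under the inverse map, the image of a Borel set is Borel, and [E |-> H(M_psi E)]
    becomes a pushforward measure. *)
Lemma image_moebius (E : set 'cV[R]_d.+1) : E `<=` sphere d ->
  moebius 1%:M psi @` E = moebius 1%:M (- psi) @^-1` E `&` sphere d.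
Proof.
move=> ES; apply/seteqP; split=> [_ [y Ey <-]|z [Ez Sz]].
  split; last by apply: moebius_sphere => //; exact: ES.
  by rewrite /= moebiusK//; exact: ES.
by exists (moebius 1%:M (- psi) z) => //; rewrite moebiusNK.
Qed.

(** The parallelogram law gives [|y + psi|^2 <= 2 + 2 |psi|^2] on the sphere. The bound supplies the
    positive constant that [integral_sandwich] asks for. *)
Lemma conformal_factor_bounded_below :
  exists2 c : R, 0 < c & forall y, sphere d y -> c <= conformal_factor psi y.
Proof.
have p0 : 0 <= enorm psi ^+ 2 by exact: sqr_ge0.
exists (`|1 - enorm psi ^+ 2| / (2 + 2 * enorm psi ^+ 2)).
  by rewrite divr_gt0 ?normr_gt0 ?one_sub_enorm_neq0//; lra.
move=> y Sy; rewrite ler_wpM2l// lef_pV2 ?posrE; last 2 first.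
- by lra.
- by rewrite lt_def sphere_addr_neq0//= sqr_ge0.
have := enorm_sqr_lin 1 1 y psi; have := enorm_sqr_lin 1 (-1) y psi.
have := sqr_ge0 (enorm (1 *: y + -1 *: psi)).
by rewrite !scale1r Sy; lra.
Qed.

Lemma hausdorff_image_moebius_le (E : set 'cV[R]_d.+1) (b : R) :
  E `<=` sphere d -> 0 < b -> (forall x, E x -> conformal_factor psi x <= b) ->
  (hausdorff_measure d (moebius 1%:M psi @` E) <=
    (b ^+ d)%:E * hausdorff_measure d E)%E.
Proof.
move=> ES b0 Eb; apply: hausdorff_measure_lipschitz => // x y Ex Ey.
rewrite -(@ler_pXn2r _ 2) ?nnegrE ?mulr_ge0 ?enorm_ge0 ?(ltW b0)//.
rewrite enorm_moebiusB//; [|exact: ES..]; rewrite exprMn ler_wpM2r ?sqr_ge0//.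
by rewrite expr2 ler_pM ?Eb// ltW// conformal_factor_gt0//; exact: ES.
Qed.

Lemma hausdorff_image_moebius_ge (E : set 'cV[R]_d.+1) (a : R) :
  E `<=` sphere d -> 0 < a -> (forall x, E x -> a <= conformal_factor psi x) ->
  ((a ^+ d)%:E * hausdorff_measure d E <=
    hausdorff_measure d (moebius 1%:M psi @` E))%E.
Proof.
move=> ES a0 Ea; rewrite -lee_pdivlMl ?exprn_gt0// -exprVn.
(* Writing [E] as the image of its own image lets the inverse map play the role of the Lipschitz
   map. *)
have {1}-> : E = moebius 1%:M (- psi) @` (moebius 1%:M psi @` E).
  apply/seteqP; split=> [x Ex|_ [_ [x Ex <-] <-]].
    exists (moebius 1%:M psi x); first by exists x.
    by rewrite moebiusK//; exact: ES.
  by rewrite moebiusK//; exact: ES.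
apply: hausdorff_measure_lipschitz; first by rewrite invr_gt0.
move=> _ _ [x Ex <-] [y Ey <-]; rewrite !moebiusK//; [|exact: ES..].
rewrite ler_pdivlMl// -(@ler_pXn2r _ 2)//
  ?nnegrE ?mulr_ge0 ?enorm_ge0 ?(ltW a0)//.
rewrite exprMn.
rewrite enorm_moebiusB//; [|exact: ES..].
by rewrite ler_wpM2r ?sqr_ge0// expr2 ler_pM ?Ea// ltW.
Qed.

Lemma integral_conformal_factor (d_gt0 : (0 < d)%N)
    (E : set (borel_cV R d.+1)) :
  measurable E -> E `<=` sphere d ->
  (\int[hausdorff_measure d]_(y in E) (conformal_factor psi y ^+ d)%:E =
   hausdorff_measure d (moebius 1%:M psi @` E))%E.
Proof.
move=> mE ES; have [c c0 lec] := conformal_factor_bounded_below.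
(* [nu] is the pushforward under [M_{-psi}] of [H] restricted to the sphere; on subsets [F] of the
   sphere it equals [H(M_psi F)]. *)
pose nu := measure_function_pushforward__canonical__measure_function_Measure
  (mrestr (@hausdorff_measure R d d.+1) (measurable_sphere (R := R) (d := d)))
  (measurable_moebius 1%:M (- psi)).
have nuE (F : set (borel_cV R d.+1)) : F `<=` sphere d ->
    nu F = hausdorff_measure d (moebius 1%:M psi @` F).
  by move=> FS; rewrite image_moebius.
rewrite -nuE//; apply: (@integral_sandwich _ _ _ _ _ _ _ (c ^+ d)) => //.
- apply: measurable_funX; apply: measurable_funTS.
  exact: measurable_conformal_factor.
- by rewrite exprn_gt0.
- by move=> x /ES Sx; rewrite lerXn2r ?nnegrE ?lec// ltW// conformal_factor_gt0.
move=> F a b mF FE /andP[a0 ab] Fab; have FS := subset_trans FE ES.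
(* The slice bounds [a] and [b] concern [lam^d]; their [d]-th roots bound [lam] itself, which is
   where [0 < d] enters. *)
have root (r : R) : 0 < r -> exists2 s, 0 < s & s ^+ d = r.
  move=> r0; exists (r `^ d%:R^-1); first exact: powR_gt0.
  rewrite -powR_mulrn ?powR_ge0// -powRrM mulVf ?powRr1 ?ltW//.
  by rewrite pnatr_eq0 -lt0n.
have [s s0 sa] := root a a0; have [t t0 tb] := root b (lt_le_trans a0 ab).
rewrite nuE// -sa -tb; apply/andP; split.
  apply: hausdorff_image_moebius_ge => // x Fx; have /andP[+ _] := Fab x Fx.
  by rewrite -sa ler_pXn2r// nnegrE ltW// conformal_factor_gt0//; exact: FS.
apply: hausdorff_image_moebius_le => // x Fx; have /andP[_] := Fab x Fx.
by rewrite -tb ler_pXn2r// nnegrE ltW// conformal_factor_gt0//; exact: FS.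
Qed.

End change_of_variables.

(** * The law of the transformed vector, in a form free of [phi] *)

Lemma cstar_moebius_law (R : realType) (d : nat) (A : 'M[R]_d.+1)
    (phi : 'cV[R]_d.+1) disp (T : measurableType disp) (P : probability T R)
    (Y : {RV P >-> borel_cV R d.+1}) (B : set (borel_cV R d.+1)) :
  (0 < d)%N -> ~ sphere d phi -> cstar_distributed P Y phi -> measurable B ->
  P ((fun w => moebius A (- phi) (Y w)) @^-1` B) =
  ((Gamma (d.+1%:R / 2) / (2 * pi `^ (d.+1%:R / 2)))%:E *
   hausdorff_measure d (mulmx A @^-1` B `&` sphere d))%E.
Proof.
move=> d0 phi_off [_ Ylaw] mB; have opp_off : ~ sphere d (- phi).
  by rewrite /sphere/= enormN.
have mZ := measurable_moebius A (- phi) measurableT mB.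
rewrite setTI in mZ; have := Ylaw _ mZ.
rewrite /distribution /pushforward => ->.
have mE := measurableI _ _ mZ (measurable_sphere (R := R) (d := d)).
(* Once [enorm phi] is replaced by [enorm (- phi)], the density is a constant times
   [conformal_factor (- phi) y ^+ d]. *)
under eq_integral do rewrite /cstar_density EFinM -(enormN phi).
rewrite ge0_integralZl//; first last.
- by rewrite lee_fin !divr_ge0 ?Gamma_ge0 ?mulr_ge0 ?powR_ge0.
- by move=> y _; rewrite lee_fin exprn_ge0// divr_ge0// sqr_ge0.
- apply/measurable_EFinP; apply: measurable_funX; apply: measurable_funTS.
  exact: measurable_conformal_factor.
rewrite [X in (_ * X)%E](integral_conformal_factor opp_off)//.
rewrite image_moebius//.
(* On the sphere [M_{-phi}] undoes [M_phi], so the condition [A M_{-phi} (M_phi z) \in B] reduces to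
   [A z \in B], and [phi] disappears. *)
congr (_ * hausdorff_measure d _)%E; apply/seteqP; split=> z [Bz Sz]; split=> //.
  case: Bz => /=; rewrite moebius_mul; have := moebiusK (psi := phi) phi_off Sz.
  by rewrite opprK => ->.
split; last by rewrite opprK; exact: moebius_sphere.
by rewrite /= moebius_mul opprK (moebiusK phi_off).
Qed.

Theorem corollary2 (R : realType) (d : nat) (d_ge1 : (1 <= d)%N)
    (A : 'M[R]_d.+1) :
  exists Q : probability (borel_cV R d.+1) R,
    forall phi : 'cV[R]_d.+1, ~ sphere d phi ->
    forall (disp : measure_display) (T : measurableType disp)
      (P : probability T R) (Y : {RV P >-> borel_cV R d.+1}),
      cstar_distributed P Y phi ->
      let Z : T -> borel_cV R d.+1 := fun w => moebius A (- phi) (Y w) in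
      measurable_fun [set: T] Z /\
      forall B : set (borel_cV R d.+1), measurable B -> pushforward P Z B = Q B.
Proof.
have mZ phi disp (T : measurableType disp) (P : probability T R)
    (Y : {RV P >-> borel_cV R d.+1}) :
    measurable_fun setT (fun w => moebius A (- phi) (Y w) : borel_cV R d.+1).
  exact: (measurableT_comp (measurable_moebius A (- phi))).
(* If some Y exists, its law under Z serves as Q; the total mass of the constant
   density on the sphere then need not be computed. *)
have [[phi [phi_off [disp [T [P [Y Ylaw]]]]]]|noY] := pselect (exists phi,
    ~ sphere d phi /\ exists disp (T : measurableType disp)
    (P : probability T R) (Y : {RV P >-> borel_cV R d.+1}),
    cstar_distributed P Y phi).
- exists (distribution P (mfun_Sub (mem_set (mZ phi _ _ _ Y)))).
  move=> phi' phi_off' disp' T' P' Y' Ylaw' Z; split; first exact: mZ.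
  move=> B mB; rewrite /distribution /pushforward.
  exact: etrans (cstar_moebius_law _ d_ge1 phi_off' Ylaw' mB)
    (esym (cstar_moebius_law _ d_ge1 phi_off Ylaw mB)).
(* No admissible [Y] exists in this case, so any probability serves; the Dirac mass at [0] is
   one. *)
- exists (\d_((0 : 'cV[R]_d.+1) : borel_cV R d.+1)).
  move=> phi phi_off disp T P Y Ylaw.
  by case: noY; exists phi; split=> //; exists disp, T, P, Y.
Qed.
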